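(* Let $X=[x_1,\dots,x_N]\in\mathbb{R}^{L\times N}$, let $\gamma>0$, and let the positive diagonal matrix $V\in\mathbb{R}^{N\times N}$ and the positive scalars $U_{nn}$ ($n=1,\dots,N$) be as described in the context. Then for every $n\in\{1,2,\dots,N\}$, Nie's $N\times N$ solver $$a_{n}=U_{nn}\left(U_{nn}X^{T}X+\gamma V\right)^{-1}X^{T}x_{n}$$ is equivalent to the $L\times L$ linear system $$a_n=U_{nn}\left(XV^{-1}\right)^{T}\left(U_{nn}X\left(XV^{-1}\right)^{T}+\gamma I_{L}\right)^{-1}x_{n},$$ where $I_L$ is the $L\times L$ identity matrix; that is, the two right-hand sides are the same vector in $\mathbb{R}^N$.
   Context: $x_n$ is the $n$-th column of $X$. The formulas are updating rules for the columns $a_n$ of $A\in\mathbb{R}^{N\times N}$ in Nie's model $\min_{A}\sum_{n}\|x_n-Xa_n\|_2+\gamma\sum_{n}\|a^{n}\|_2$, where $a_n$ and $a^n$ denote the $n$-th column and $n$-th row of $A$. In the updating rule, $V$ and $U_{nn}$ are given quantities computed from the current iterate (an arbitrary real $N\times N$ matrix with columns $a_n$ and rows $a^n$), and are held fixed: $V$ is diagonal with $V_{nn}=\frac{1}{2\sqrt{\|a^n\|_2^2+\epsilon}}$, and $U_{nn}=\frac{1}{2\sqrt{\|x_n-Xa_n\|_2^2+\epsilon}}$, where $\epsilon>0$ is a fixed small constant to avoid singularities. *)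

(* Defs.v *)
From HB Require Import structures.
From mathcomp Require Import all_boot all_order all_algebra.

Set Implicit Arguments.
Unset Strict Implicit.
Unset Printing Implicit Defensive.

Import Order.TTheory GRing.Theory Num.Theory.
Local Open Scope ring_scope.

(* Applied below only to row and column vectors, where the double sum is the
   usual sum of squares over the coordinates. *)
Definition l2norm (R : rcfType) (m n : nat) (u : 'M[R]_(m, n)) : R :=
  Num.sqrt (\sum_(i < m) \sum_(j < n) u i j ^+ 2).

(* The weights of the iteratively reweighted least-squares scheme for
     min_A  \sum_n ||x_n - X a_n||_2 + gamma * \sum_n ||a^n||_2,
   smoothed by eps and evaluated at the current iterate A; x_n = col n X,
   a_n = col n A (column) and a^n = row n A (row). *)
Definition Vweight (R : rcfType) (N : nat) (eps : R) (A : 'M[R]_N) : 'M[R]_N :=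
  diag_mx (\row_(n < N) (1 / (2 * Num.sqrt (l2norm (row n A) ^+ 2 + eps)))).

Definition Uweight (R : rcfType) (L N : nat) (eps : R) (X : 'M[R]_(L, N))
    (A : 'M[R]_N) (n : 'I_N) : R :=
  1 / (2 * Num.sqrt (l2norm (col n X - X *m col n A) ^+ 2 + eps)).

(* Main.v *)
(* Both matrices to be inverted are positive definite, and the push-through
   identity (u X^T X + g V) V^-1 X^T = X^T (u X V^-1 X^T + g I) moves X^T from
   one side of the inverse to the other. *)
Require Import Defs.
From mathcomp Require Import all_boot all_order all_algebra.

Set Implicit Arguments.
Unset Strict Implicit.
Unset Printing Implicit Defensive.

Import Order.TTheory GRing.Theory Num.Theory.
Local Open Scope ring_scope.

(** Put P = u X^T X + g V and Q = u X V^-1 X^T + g I. Both P V^-1 X^T and X^T Q expand to u X^T X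
    V^-1 X^T + g X^T, so cancelling P on the left and Q on the right gives P^-1 X^T = V^-1 X^T Q^-1
    ([push_through_invmx]). As V is diagonal, V^-1 X^T is (X V^-1)^T. Invertibility of P and Q comes
    from one lemma, [weighted_gram_unitmx], since both have the shape u Y^T C Y + g D with C, D
    diagonal, C nonnegative and D positive. *)

Lemma quad_diag_mx (R : comNzRingType) (n : nat) (v d : 'rV[R]_n) :
  (v *m diag_mx d *m v^T) 0 0 = \sum_j d 0 j * v 0 j ^+ 2.
Proof.
rewrite mxE; apply: eq_bigr => j _.
by rewrite mul_mx_diag !mxE mulrAC mulrC expr2.
Qed.

(* The matrix is positive definite: its quadratic form vanishes only at 0. *)
Lemma weighted_gram_unitmx (R : realFieldType) (m n : nat) (Y : 'M[R]_(m, n))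
    (c : 'rV[R]_m) (d : 'rV[R]_n) (u g : R) :
  0 <= u -> 0 < g -> (forall i, 0 <= c 0 i) -> (forall j, 0 < d 0 j) ->
  u *: (Y^T *m diag_mx c *m Y) + g *: diag_mx d \in unitmx.
Proof.
move=> u_ge0 g_gt0 c_ge0 d_gt0.
set M := _ + _; rewrite -row_free_unit -kermx_eq0; apply/rowV0P => v /sub_kermxP vM0.
have form0 : (v *m M *m v^T) 0 0 = 0 by rewrite vM0 mul0mx mxE.
have formE : v *m M *m v^T =
    u *: ((v *m Y^T) *m diag_mx c *m (v *m Y^T)^T) + g *: (v *m diag_mx d *m v^T).
  by rewrite mulmxDr mulmxDl -!scalemxAr -!scalemxAl trmx_mul trmxK !mulmxA.
move: form0; rewrite formE mxE [X in X + _]mxE [X in _ + X]mxE !quad_diag_mx.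
have sum_ge0 p (w e : 'rV[R]_p) :
    (forall j, 0 <= e 0 j) -> 0 <= \sum_j e 0 j * w 0 j ^+ 2.
  by move=> e_ge0; apply: sumr_ge0 => j _; rewrite mulr_ge0 ?sqr_ge0.
have d_ge0 j : 0 <= d 0 j by exact: ltW.
(* Two nonnegative terms sum to zero, so the [d] term vanishes; its weights are positive, which
   forces every coordinate of [v] to be 0. *)
move/eqP; rewrite paddr_eq0 ?mulr_ge0 ?sum_ge0 ?(ltW g_gt0) // => /andP[_].
rewrite mulf_eq0 gt_eqF //= psumr_eq0 => [/allP s0|j _]; last first.
  by rewrite mulr_ge0 ?sqr_ge0.
apply/rowP => j; rewrite mxE; apply/eqP.
by have := s0 j (mem_index_enum j); rewrite /= mulf_eq0 gt_eqF //= sqrf_eq0.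
Qed.

Lemma invmx_diag (R : fieldType) (n : nat) (d : 'rV[R]_n) :
  (forall j, d 0 j != 0) ->
  diag_mx d \in unitmx /\ invmx (diag_mx d) = diag_mx (\row_j (d 0 j)^-1).
Proof.
move=> d_neq0.
have dV : diag_mx d *m diag_mx (\row_j (d 0 j)^-1) = 1%:M.
  rewrite mulmx_diag -diag_const_mx; congr diag_mx.
  by apply/rowP => j; rewrite !mxE divff.
have [d_unit _] := mulmx1_unit dV; split=> //.
by rewrite -[RHS]mul1mx -(mulVmx d_unit) -mulmxA dV mulmx1.
Qed.

Lemma push_through_invmx (R : comUnitRingType) (L N : nat) (X : 'M[R]_(L, N))
    (V : 'M[R]_N) (u g : R) :
  let P := u *: (X^T *m X) + g *: V in
  let Q := u *: (X *m (invmx V *m X^T)) + g *: 1%:M in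
  V \in unitmx -> P \in unitmx -> Q \in unitmx ->
  invmx P *m X^T = invmx V *m X^T *m invmx Q.
Proof.
move=> P Q V_unit P_unit Q_unit.
have PQ : P *m (invmx V *m X^T) = X^T *m Q.
  rewrite mulmxDl mulmxDr -!scalemxAl -!scalemxAr mulmx1 !mulmxA.
  by rewrite mulmxV // mul1mx.
by rewrite -[X^T in LHS](mulmxK Q_unit) -PQ !mulmxA mulVmx // mul1mx.
Qed.

Lemma smoothed_weight_gt0 (R : rcfType) (eps t : R) :
  0 < eps -> 0 < 1 / (2 * Num.sqrt (t ^+ 2 + eps)).
Proof.
by move=> eps_gt0; rewrite divr_gt0 // mulr_gt0 // sqrtr_gt0 ltr_wpDl ?sqr_ge0.
Qed.

(* invmx M is M itself when M is singular, so the invertibility that the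
   displayed formulas presuppose is part of the conclusion. *)
Theorem theorem4 (R : rcfType) (L N : nat) (X : 'M[R]_(L, N)) (gamma eps : R)
    (A : 'M[R]_N) (n : 'I_N) (gamma_gt0 : 0 < gamma) (eps_gt0 : 0 < eps) :
  let V := Vweight eps A in
  let u := Uweight eps X A n in
  let x := col n X in
  [/\ V \in unitmx,
      u *: (X^T *m X) + gamma *: V \in unitmx,
      u *: (X *m (X *m invmx V)^T) + gamma *: 1%:M \in unitmx
    & u *: (invmx (u *: (X^T *m X) + gamma *: V) *m X^T *m x) =
      u *: ((X *m invmx V)^T
              *m invmx (u *: (X *m (X *m invmx V)^T) + gamma *: 1%:M) *m x)].
Proof.
move=> V u x.
have u_gt0 : 0 < u by exact: smoothed_weight_gt0.
pose d : 'rV[R]_N := \row_k (1 / (2 * Num.sqrt (l2norm (row k A) ^+ 2 + eps))).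
have d_gt0 k : 0 < d 0 k by rewrite mxE smoothed_weight_gt0.
have [V_unit V_inv] := invmx_diag (fun k => lt0r_neq0 (d_gt0 k)).
rewrite -[diag_mx d]/V in V_unit V_inv.
have XVT : (X *m invmx V)^T = invmx V *m X^T.
  by rewrite trmx_mul V_inv tr_diag_mx.
have P_unit : u *: (X^T *m X) + gamma *: V \in unitmx.
  (* Weighted Gram shape with [Y] = [X], [c] constantly 1 and [d] the diagonal of [V]. *)
  rewrite -[X^T]mulmx1 -diag_const_mx.
  by apply: weighted_gram_unitmx => //; [exact: ltW | move=> i; rewrite mxE ler01].
have Q_unit : u *: (X *m (invmx V *m X^T)) + gamma *: 1%:M \in unitmx.
  (* The same shape with the roles exchanged: [Y] = [X^T], [c] the diagonal of [invmx V] and [d]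
     constantly 1. *)
  rewrite mulmxA -[X in X *m _ *m _]trmxK V_inv -diag_const_mx.
  apply: weighted_gram_unitmx => //; first exact: ltW.
    by move=> k; rewrite mxE invr_ge0 ltW.
  by move=> k; rewrite mxE ltr01.
by rewrite XVT push_through_invmx.
Qed.
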